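(* Let $X_1,X_2$ be non-negative absolutely continuous random variables with probability density functions $f_1,f_2$, let $0<r<1$, $\gamma>0$, $\beta\ge1$, and let $\omega\ge0$ be a weight function. Let $M(r,\gamma)$ be the $(r,\gamma)$-mixture random variable of $f_1,f_2$, and let $K(\tfrac1\gamma,\Gamma)$ be the escort random variable of order $\tfrac1\gamma$ with baseline density $f_\Gamma$. Then, for $i=1,2$, $$R_\beta^\omega(M(r,\gamma),X_i)=R_\beta^\omega\left(K\left(\tfrac1\gamma,\Gamma\right),X_i\right).$$
   Context: For non-negative absolutely continuous random variables $X,Y$ with densities $f,g$, a measurable weight $\omega\ge0$ and $\beta\ge1$, the general weighted relative information generating function (GWRIGF) is $R_\beta^\omega(X,Y)=\int_0^\infty\omega(x)f^\beta(x)g^{1-\beta}(x)\,dx$. For $p>0$, $I_p(X)=\int_0^\infty f^p(u)\,du$. The $(r,\gamma)$-mixture random variable $M(r,\gamma)$ has density $f_{M(r,\gamma)}(x)=\dfrac{[rf_1^\gamma(x)+(1-r)f_2^\gamma(x)]^{1/\gamma}}{\int_0^\infty[rf_1^\gamma(u)+(1-r)f_2^\gamma(u)]^{1/\gamma}\,du}$, $x>0$. Put $f_{(\gamma,i)}(x)=f_i^\gamma(x)/\int_0^\infty f_i^\gamma(u)\,du$ for $i=1,2$, $\Gamma=\dfrac{rI_\gamma(X_1)}{rI_\gamma(X_1)+(1-r)I_\gamma(X_2)}$, and $f_\Gamma(x)=\Gamma f_{(\gamma,1)}(x)+(1-\Gamma)f_{(\gamma,2)}(x)$. The random variable $K(\tfrac1\gamma,\Gamma)$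 has density $f_\Gamma^{1/\gamma}(x)\big/\int_0^\infty f_\Gamma^{1/\gamma}(u)\,du$, $x>0$. All integrals are assumed to exist. *)

(* Defs.v *)
From HB Require Import structures.
From mathcomp Require Import all_boot all_order all_algebra.
From mathcomp Require Import all_classical all_reals all_analysis.
From mathcomp Require Import measurable_realfun.

Set Implicit Arguments.
Unset Strict Implicit.
Unset Printing Implicit Defensive.

Import Order.TTheory GRing.Theory Num.Theory.
Import numFieldNormedType.Exports.

Local Open Scope classical_set_scope.
Local Open Scope ring_scope.

(* The half-line on which all integrals are taken. *)
Definition pos_line (R : realType) : set R := `]0, +oo[.

Definition has_pdf (d : measure_display) (T : measurableType d) (R : realType)
    (P : probability T R) (X : {RV P >-> R}) (f : R -> R) : Prop :=
  [/\ measurable_fun setT f, (forall x, 0 <= f x) &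
      forall A, measurable A ->
        distribution P X A = (\int[lebesgue_measure]_(x in A) (f x)%:E)%E].

(* A chosen version of the density, determined up to a null set
   (see [has_pdf_ae_unique]); the zero function if X has no density. *)
Definition pdf_of (d : measure_display) (T : measurableType d) (R : realType)
    (P : probability T R) (X : {RV P >-> R}) : R -> R :=
  xget (fun=> 0) [set f | has_pdf X f].

(* x ^ s for x >= 0, with 0 ^ s = +oo for s < 0, where [powR] gives 0. *)
Definition epow (R : realType) (x s : R) : \bar R :=
  if (x == 0) && (s < 0) then +oo%E else (x `^ s)%:E.

(* The integrand uses 0 * +oo = 0, so it vanishes where f does; if f > 0 on a
   set of positive measure on which g = 0, w > 0 and beta > 1, the value is
   +oo. *)
Definition gwrigf_pdf (R : realType) (w : R -> R) (beta : R) (f g : R -> R)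
    : \bar R :=
  (\int[lebesgue_measure]_(x in @pos_line R)
     ((w x)%:E * (f x `^ beta)%:E * epow (g x) (1 - beta)))%E.

Definition gwrigf (R : realType) (w : R -> R) (beta : R)
    (d : measure_display) (T : measurableType d) (P : probability T R)
    (X : {RV P >-> R})
    (d' : measure_display) (T' : measurableType d') (P' : probability T' R)
    (Y : {RV P' >-> R}) : \bar R :=
  gwrigf_pdf w beta (pdf_of X) (pdf_of Y).

(* Finiteness of the integral over the half-line. *)
Definition integrable_pos (R : realType) (h : R -> R) : Prop :=
  (@lebesgue_measure R).-integrable (@pos_line R) (EFin \o h).

Definition info_gen (R : realType) (p : R) (f : R -> R) : R :=
  \int[lebesgue_measure]_(u in @pos_line R) (f u `^ p).

Definition escort_pdf (R : realType) (p : R) (f : R -> R) (x : R) : R :=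
  if 0 < x then f x `^ p / info_gen p f else 0.

Definition mixture_kernel (R : realType) (r gamma : R) (f1 f2 : R -> R)
    (x : R) : R :=
  (r * f1 x `^ gamma + (1 - r) * f2 x `^ gamma) `^ gamma^-1.

Definition mixture_pdf (R : realType) (r gamma : R) (f1 f2 : R -> R)
    (x : R) : R :=
  if 0 < x then
    mixture_kernel r gamma f1 f2 x /
      \int[lebesgue_measure]_(u in @pos_line R) mixture_kernel r gamma f1 f2 u
  else 0.

Definition Gamma_weight (R : realType) (r gamma : R) (f1 f2 : R -> R) : R :=
  r * info_gen gamma f1 /
    (r * info_gen gamma f1 + (1 - r) * info_gen gamma f2).

Definition f_Gamma (R : realType) (r gamma : R) (f1 f2 : R -> R) (x : R) : R :=
  let G := Gamma_weight r gamma f1 f2 in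
  G * escort_pdf gamma f1 x + (1 - G) * escort_pdf gamma f2 x.

Section pdf_theory.
Context (R : realType).
Local Notation mu := (@lebesgue_measure R).

Lemma has_pdf_ae_unique (d : measure_display) (T : measurableType d)
    (P : probability T R) (X : {RV P >-> R}) (f g : R -> R) :
  has_pdf X f -> has_pdf X g -> ae_eq mu setT f g.
Proof.
move=> [mf f0 fX] [mg g0 gX].
have : ae_eq mu setT (EFin \o f) (EFin \o g).
  apply: integral_ae_eq => //; last first.
  - by move=> E _ mE; rewrite -fX// -gX.
  - exact/measurable_EFinP.
  apply/integrableP; split; first exact/measurable_EFinP.
  under eq_integral do rewrite /= ger0_norm//.
  by rewrite -fX//= probability_setT ltry.
by apply: filterS => x /= fg _; have [] := fg I.
Qed.

Lemma has_pdf_pdf_of (d : measure_display) (T : measurableType d)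
    (P : probability T R) (X : {RV P >-> R}) (f : R -> R) :
  has_pdf X f -> has_pdf X (pdf_of X).
Proof. by move=> fX; apply: (xgetPex (fun=> 0)); exists f. Qed.

Lemma measurable_epow (s : R) : measurable_fun setT (fun x : R => epow x s).
Proof.
rewrite /epow; apply: measurable_fun_ifT => //; last first.
  by apply/measurable_EFinP; exact: measurable_powR.
apply: measurable_and; last exact: measurable_cst.
apply: (measurable_fun_bool true).
rewrite setTI (_ : _ @^-1` _ = [set 0]); last first.
  by apply/seteqP; split=> x /= => [/eqP|->]; rewrite ?eqxx.
exact: measurable_set1.
Qed.

(* [gwrigf] does not depend on the chosen versions of the densities. *)
Lemma gwrigfE (w : R -> R) (beta : R)
    (d : measure_display) (T : measurableType d) (P : probability T R)
    (X : {RV P >-> R})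
    (d' : measure_display) (T' : measurableType d') (P' : probability T' R)
    (Y : {RV P' >-> R}) (f g : R -> R) :
  measurable_fun (@pos_line R) w -> has_pdf X f -> has_pdf Y g ->
  gwrigf w beta X Y = gwrigf_pdf w beta f g.
Proof.
move=> mw fX gY.
have fX' := has_pdf_pdf_of fX; have gY' := has_pdf_pdf_of gY.
have mD : measurable (@pos_line R) by exact: measurable_itv.
have mI (h k : R -> R) : measurable_fun setT h -> measurable_fun setT k ->
    measurable_fun (@pos_line R) (fun x =>
      (w x)%:E * (h x `^ beta)%:E * epow (k x) (1 - beta))%E.
  move=> mh mk; apply: emeasurable_funM.
    apply: emeasurable_funM; first exact/measurable_EFinP.
    apply/measurable_EFinP/measurable_funTS.
    exact: (measurableT_comp (measurable_powR _)).
  apply: measurable_funTS.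
  exact: (measurableT_comp (measurable_epow _)).
apply: ae_eq_integral => //.
- by case: fX' => ? _ _; case: gY' => ? _ _; exact: mI.
- by case: fX => ? _ _; case: gY => ? _ _; exact: mI.
have := has_pdf_ae_unique fX' fX; have := has_pdf_ae_unique gY' gY.
by apply: filterS2 => x /= gg ff _; rewrite ff// gg.
Qed.

End pdf_theory.

(* Main.v *)
(* Since each X_i is non-negative, I_gamma(X_i) > 0, so with
   S = r I_gamma(X_1) + (1 - r) I_gamma(X_2) the baseline satisfies
   S f_Gamma = r f_1^gamma + (1 - r) f_2^gamma. The mixture kernel is therefore
   S^(1/gamma) f_Gamma^(1/gamma), and normalising removes the constant: M and K
   have the same density. *)
Require Import Defs.
From mathcomp Require Import all_boot all_order all_algebra.
From mathcomp Require Import all_classical all_reals all_analysis.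
From mathcomp Require Import measurable_realfun ring.

Import Order.TTheory GRing.Theory Num.Theory.
Import numFieldNormedType.Exports.

Local Open Scope classical_set_scope.
Local Open Scope ring_scope.

(** The law of a non-negative variable gives no mass to the negative half-line, and a law with a
    density has no atom at 0, so the total mass 1 sits on the open half-line. *)
Lemma has_pdf_pos_line_mass {R : realType} {d : measure_display}
    {T : measurableType d} {P : probability T R} {X : {RV P >-> R}}
    {f : R -> R} :
  (forall t, 0 <= X t) -> has_pdf X f ->
  (\int[lebesgue_measure]_(x in @pos_line R) (f x)%:E = 1)%E.
Proof.
move=> X0 [mf f0 fX].
have dneg : distribution P X `]-oo, 0[ = 0%E.
  rewrite /distribution /pushforward (_ : X @^-1` _ = set0) ?measure0//.
  by apply/seteqP; split=> t //=; rewrite in_itv/= ltNge X0.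
have dzero : distribution P X [set 0] = 0%E by rewrite fX// integral_set1.
rewrite -fX; last exact: measurable_itv.
have <- : distribution P X setT = 1%E by exact: probability_setT.
have -> : [set: R] = (`]-oo, 0[ `|` [set 0]) `|` @pos_line R.
  apply/seteqP; split=> x //= _; rewrite /pos_line/= !in_itv/= andbT.
  by case: (ltgtP x 0) => [||->]; [left; left|right|left; right].
rewrite measureU//=; [|exact: measurableU|exact: measurable_itv|]; last first.
  apply/seteqP; split=> x //=; rewrite /pos_line/= !in_itv/= andbT.
  by case=> -[/lt_trans h /h|->]; rewrite ltxx.
rewrite measureU//=; last first.
  by apply/seteqP; split=> x //=; rewrite in_itv/= => -[/[swap] ->]; rewrite ltxx.
by rewrite [X in (X + _ + _)%E]dneg [X in (_ + X + _)%E]dzero !add0e.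
Qed.

Lemma info_gen_gt0 {R : realType} {d : measure_display}
    {T : measurableType d} {P : probability T R} {X : {RV P >-> R}}
    {f : R -> R} {p : R} :
  (forall t, 0 <= X t) -> has_pdf X f -> p != 0 ->
  integrable_pos (fun u => f u `^ p) -> 0 < info_gen p f.
Proof.
move=> X0 fX p0 fin; rewrite lt0r Rintegral_ge0 ?andbT; last first.
  by move=> x _; exact: powR_ge0.
apply/eqP => I0; have mD : measurable (@pos_line R) by exact: measurable_itv.
have : (\int[lebesgue_measure]_(x in @pos_line R) `|(f x `^ p)%:E| = 0)%E.
  under eq_integral do rewrite gee0_abs ?lee_fin ?powR_ge0//.
  (* The real-valued integral is [fine] of the extended one and [fine] sends +oo to 0, so
     integrability is what lets a zero real value force a zero extended integral. *)
  by rewrite -[LHS]fineK ?integrable_fin_num//; congr EFin.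
move/ae_eq_integral_abs => /(_ mD (measurable_int _ fin)) fp0.
suff f0 : ae_eq lebesgue_measure (@pos_line R) (EFin \o f) (cst 0%E).
  have := has_pdf_pos_line_mass X0 fX.
  rewrite (ae_eq_integral (cst 0%E))//.
    by rewrite integral0 => /eqP; rewrite eq_sym onee_eq0.
  by case: fX => mf _ _; apply/measurable_EFinP/measurable_funTS.
apply: filterS fp0 => x /= fp0 Dx.
by have [/powR_eq0_eq0 ->] := fp0 Dx.
Qed.

Lemma convex_combination_gt0 {R : realType} (r a b : R) :
  0 < r < 1 -> 0 < a -> 0 < b -> 0 < r * a + (1 - r) * b.
Proof.
by move=> /andP[r0 r1] a0 b0; rewrite addr_gt0// mulr_gt0// subr_gt0.
Qed.

(** With S the denominator on the right, Gamma / I_gamma(X_1) = r / S and (1 - Gamma) / I_gamma(X_2)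
    = (1 - r) / S: the weight Gamma is chosen to undo the normalisation of the two escort
    densities. *)
Lemma f_GammaE {R : realType} (r gamma : R) (f1 f2 : R -> R) (x : R) :
  0 < r < 1 -> 0 < info_gen gamma f1 -> 0 < info_gen gamma f2 -> 0 < x ->
  f_Gamma r gamma f1 f2 x =
  (r * f1 x `^ gamma + (1 - r) * f2 x `^ gamma) /
  (r * info_gen gamma f1 + (1 - r) * info_gen gamma f2).
Proof.
move=> r01 + + x0; rewrite /f_Gamma /escort_pdf x0 /Gamma_weight.
move: (info_gen _ f1) (info_gen _ f2) => a b a0 b0.
have := convex_combination_gt0 _ _ _ r01 a0 b0.
move: a0 b0 => /lt0r_neq0 a0 /lt0r_neq0 b0 /lt0r_neq0 S0.
by field; rewrite S0 a0 b0.
Qed.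

Lemma mixture_pdf_escort {R : realType} (r gamma : R) (f1 f2 : R -> R) :
  0 < r < 1 -> 0 < info_gen gamma f1 -> 0 < info_gen gamma f2 ->
  integrable_pos (fun u => f_Gamma r gamma f1 f2 u `^ gamma^-1) ->
  mixture_pdf r gamma f1 f2 = escort_pdf gamma^-1 (f_Gamma r gamma f1 f2).
Proof.
move=> r01 I1 I2 fin; have /andP[r0 r1] := r01.
set S := r * info_gen gamma f1 + (1 - r) * info_gen gamma f2.
have S0 : 0 < S by exact: convex_combination_gt0.
have kE x : 0 < x -> mixture_kernel r gamma f1 f2 x =
    S `^ gamma^-1 * f_Gamma r gamma f1 f2 x `^ gamma^-1.
  (* Both bases are non-negative, so the two powers merge into one power of a product, where [S]
     cancels. *)
  move=> x0; rewrite (f_GammaE _ _ _ _ _ r01 I1 I2 x0) -/S -powRM; first 1 last.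
  - exact: ltW.
  - rewrite divr_ge0 ?(ltW S0)// addr_ge0// mulr_ge0 ?powR_ge0 ?subr_ge0//;
    exact: ltW.
  by rewrite mulrC divfK ?gt_eqF.
have IE : \int[lebesgue_measure]_(u in @pos_line R)
      mixture_kernel r gamma f1 f2 u =
    S `^ gamma^-1 * info_gen gamma^-1 (f_Gamma r gamma f1 f2).
  (* Integrability of the power of [f_Gamma] justifies moving the constant through the integral. *)
  rewrite -RintegralZl//; last exact: measurable_itv.
  apply: eq_Rintegral => x; rewrite inE /pos_line/= in_itv/= andbT.
  exact: kE.
apply/funext => x; rewrite /mixture_pdf /escort_pdf IE.
case: ifP => [x0|_]; last by [].
move: (info_gen _ _) => c; rewrite (kE _ x0) -mulf_div divff ?mul1r//.
by rewrite gt_eqF// powR_gt0.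
Qed.

Theorem theorem4p4 (R : realType)
  (d1 d2 dM dK : measure_display)
  (T1 : measurableType d1) (T2 : measurableType d2)
  (TM : measurableType dM) (TK : measurableType dK)
  (P1 : probability T1 R) (P2 : probability T2 R)
  (PM : probability TM R) (PK : probability TK R)
  (X1 : {RV P1 >-> R}) (X2 : {RV P2 >-> R})
  (M : {RV PM >-> R}) (K : {RV PK >-> R})
  (f1 f2 w : R -> R) (r gamma beta : R)
  (X1_ge0 : forall t, 0 <= X1 t) (X2_ge0 : forall t, 0 <= X2 t)
  (X1_pdf : has_pdf X1 f1) (X2_pdf : has_pdf X2 f2)
  (r_gt0 : 0 < r) (r_lt1 : r < 1) (gamma_gt0 : 0 < gamma) (beta_ge1 : 1 <= beta)
  (w_meas : measurable_fun (@pos_line R) w)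
  (w_ge0 : forall x, 0 < x -> 0 <= w x)
  (I1_fin : integrable_pos (fun u => f1 u `^ gamma))
  (I2_fin : integrable_pos (fun u => f2 u `^ gamma))
  (M_fin : integrable_pos (mixture_kernel r gamma f1 f2))
  (K_fin : integrable_pos (fun u => f_Gamma r gamma f1 f2 u `^ gamma^-1))
  (M_pdf : has_pdf M (mixture_pdf r gamma f1 f2))
  (K_pdf : has_pdf K (escort_pdf gamma^-1 (f_Gamma r gamma f1 f2))) :
  gwrigf w beta M X1 = gwrigf w beta K X1 /\
  gwrigf w beta M X2 = gwrigf w beta K X2.
Proof.
have I1 := info_gen_gt0 X1_ge0 X1_pdf (lt0r_neq0 gamma_gt0) I1_fin.
have I2 := info_gen_gt0 X2_ge0 X2_pdf (lt0r_neq0 gamma_gt0) I2_fin.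
have r01 : 0 < r < 1 by rewrite r_gt0.
(* [M] and [K] now share one density. As [gwrigf] is built on chosen versions of densities,
   [gwrigfE] is then used to turn both sides into the same explicit integral. *)
move: M_pdf; rewrite (mixture_pdf_escort _ _ _ _ r01 I1 I2 K_fin) => M_pdf'.
split.
  by rewrite (gwrigfE _ w_meas M_pdf' X1_pdf) (gwrigfE _ w_meas K_pdf X1_pdf).
by rewrite (gwrigfE _ w_meas M_pdf' X2_pdf) (gwrigfE _ w_meas K_pdf X2_pdf).
Qed.
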